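(* Let $a, k, c \in \mathbb{R}$ be constants and let $\Delta x, \Delta t > 0$ be arbitrary. Define $g:\mathbb{R}\to e^{\mathbb{C}}$ by $g(x) = \exp(-ax^2 + ikx)$. Let $v^n_j \in e^{\mathbb{C}}$ ($j\in\mathbb{Z}$, $n \geq -1$ an integer) be the grid function determined by $$ v^{0}_j = g(j\Delta x), \qquad v^{-1}_j = g(j\Delta x + c\Delta t), $$ and, for all $n\ge 0$ and $j\in\mathbb{Z}$, $$ v^{n+1}_j = v^{n-1}_j\left( \frac{v^n_{j+1}}{v^n_{j-1}} \right)^{-c\Delta t/\Delta x}. $$ Then $v^n_j = g(j\Delta x - c\,n\Delta t)$ for all $j\in\mathbb{Z}$ and all $n\geq 0$; that is, the scheme reproduces at every grid point $(x_j,t_n)=(j\Delta x,n\Delta t)$ the exact solution $v(x,t)=g(x-ct)$ of $v^*_t\,(v^*_x)^c = 1$, $v(x,0)=g(x)$, regardless of $\Delta x$, $\Delta t$, $c$ and $k$.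
   Context: $e^{\mathbb{C}} = \{(r,\theta): r>0,\ \theta\in\mathbb{R}\}$ is the Riemann surface of the logarithm. The bijection $\exp:\mathbb{C}\to e^{\mathbb{C}}$ is $\exp(a+ib) = (e^a,b)$, with inverse $\log(r,\theta) = \ln r + i\theta$. Operations on $e^{\mathbb{C}}$: $(r_1,\theta_1)(r_2,\theta_2) = (r_1r_2,\theta_1+\theta_2)$, $(r_1,\theta_1)/(r_2,\theta_2) = (r_1/r_2,\theta_1-\theta_2)$, and $z^w = \exp(w\log z)$ for $z\in e^{\mathbb{C}}$, $w\in\mathbb{C}$. The identity $1\in e^{\mathbb{C}}$ is $(1,0)$. For an $e^{\mathbb{C}}$-valued function $v(x,t)$, the partial *derivatives are $v^*_x = \exp(\partial_x \log v)$ and $v^*_t = \exp(\partial_t\log v)$. *)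

(* Defs.v *)
(* Concrete reals of the standard library, with Coquelicot's complex numbers
   and derivatives. *)
From Stdlib Require Import Reals ZArith.
From Coquelicot Require Import Coquelicot.
Open Scope R_scope.

(* Riemann surface of the logarithm: pairs (r, theta) with r > 0.  The angle is
   a plain real number, not taken modulo 2 PI. *)
Definition eC : Type := (posreal * R)%type.

Definition eexp (z : C) : eC := (mkposreal (exp (Re z)) (exp_pos (Re z)), Im z).

Definition elog (z : eC) : C := (ln (fst z), snd z).

Definition eone : eC := (mkposreal 1 Rlt_0_1, 0).

Definition emul (z w : eC) : eC :=
  (mkposreal (fst z * fst w)
     (Rmult_lt_0_compat _ _ (cond_pos (fst z)) (cond_pos (fst w))),
   snd z + snd w).

Definition ediv (z w : eC) : eC :=
  (mkposreal (fst z / fst w)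
     (Rdiv_lt_0_compat _ _ (cond_pos (fst z)) (cond_pos (fst w))),
   snd z - snd w).

Definition epow (z : eC) (w : C) : eC := eexp (w * elog z)%C.

Declare Scope eC_scope.
Delimit Scope eC_scope with eC.
Bind Scope eC_scope with eC.
Notation "1" := eone : eC_scope.
Infix "*" := emul : eC_scope.
Infix "/" := ediv : eC_scope.
Infix "^" := epow : eC_scope.

(* [d] is the partial *derivative of [v] at [(x, t)]; the inner derivative is
   that of a C-valued function of one real variable. *)
Definition is_starderive_x (v : R -> R -> eC) (x t : R) (d : eC) : Prop :=
  exists l : C,
    @is_derive R_AbsRing C_R_NormedModule (fun y => elog (v y t)) x l /\
    d = eexp l.

Definition is_starderive_t (v : R -> R -> eC) (x t : R) (d : eC) : Prop :=
  exists l : C,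
    @is_derive R_AbsRing C_R_NormedModule (fun s => elog (v x s)) t l /\
    d = eexp l.

(* Differentiability of [log v] as a function of two real variables, which is
   more than the existence of both partial *derivatives. *)
Definition star_differentiable (v : R -> R -> eC) : Prop :=
  forall x t : R,
    @ex_filterdiff R_AbsRing
      (prod_NormedModule R_AbsRing R_NormedModule R_NormedModule)
      C_R_NormedModule
      (fun p : R * R => elog (v (fst p) (snd p))) (locally (x, t)).

(* Classical solutions of v*_t (v*_x)^c = 1, v(x,0) = g(x). *)
Definition exact_solution (c : R) (g : R -> eC) (v : R -> R -> eC) : Prop :=
  star_differentiable v /\
  (forall x t : R, exists dx dt : eC,
     is_starderive_x v x t dx /\ is_starderive_t v x t dt /\
     (dt * dx ^ RtoC c)%eC = 1%eC) /\
  (forall x : R, v x 0 = g x).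

Definition gauss (a k x : R) : eC :=
  eexp (- RtoC a * RtoC x ^ 2 + Ci * RtoC k * RtoC x)%C.

(* The three-level scheme; [v n j] is the value at time level [n] and space
   index [j].  Levels [n < -1] are not constrained. *)
Definition is_scheme (c Dx Dt : R) (g : R -> eC) (v : Z -> Z -> eC) : Prop :=
  (forall j : Z, v 0%Z j = g (IZR j * Dx)) /\
  (forall j : Z, v (-1)%Z j = g (IZR j * Dx + c * Dt)) /\
  (forall n j : Z, (0 <= n)%Z ->
     v (n + 1)%Z j =
       (v (n - 1)%Z j *
        (v n (j + 1)%Z / v n (j - 1)%Z) ^ RtoC (- c * Dt / Dx))%eC).

(* Main.v *)
Require Import Defs.
From Stdlib Require Import Reals ZArith Lra Lia ProofIrrelevance.
From Coquelicot Require Import Coquelicot.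
Open Scope R_scope.

(** The logarithm is a group isomorphism from [eC] onto the additive group of
    [C], so every assertion can be read on logarithms.  There the scheme becomes
    the leapfrog scheme for [u_t + c u_x = 0], with initial datum the quadratic
    polynomial [- a x^2 + i k x], on which central differences are exact; the
    numerical solution is therefore the travelling wave, by induction over pairs
    of consecutive time levels.  Uniqueness of the exact solution is the method of
    characteristics: [log w] has derivative zero along [s |-> (x + c s, s)]. *)

Lemma posreal_eq (p q : posreal) : pos p = pos q -> p = q.
Proof.
  destruct p as [p hp], q as [q hq]; simpl; intros ->.
  f_equal; apply proof_irrelevance.
Qed.

Lemma elog_eexp (z : C) : elog (eexp z) = z.
Proof. destruct z as [x y]; unfold elog, eexp; simpl; now rewrite ln_exp. Qed.

Lemma eexp_elog (z : eC) : eexp (elog z) = z.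
Proof.
  destruct z as [r y]; unfold elog, eexp; simpl; f_equal.
  apply posreal_eq; simpl; apply exp_ln, cond_pos.
Qed.

Lemma elog_inj (z w : eC) : elog z = elog w -> z = w.
Proof. intros h; now rewrite <- (eexp_elog z), h, eexp_elog. Qed.

Lemma elog_one : elog 1%eC = RtoC 0.
Proof. unfold elog; simpl; now rewrite ln_1. Qed.

Lemma elog_mul (z w : eC) : elog (z * w)%eC = (elog z + elog w)%C.
Proof.
  unfold elog, emul, Cplus; simpl; f_equal.
  apply ln_mult; apply cond_pos.
Qed.

Lemma elog_div (z w : eC) : elog (z / w)%eC = (elog z - elog w)%C.
Proof.
  unfold elog, ediv, Cminus, Cplus, Copp; simpl; f_equal.
  apply ln_div; apply cond_pos.
Qed.

Lemma elog_pow (z : eC) (w : C) : elog (z ^ w)%eC = (w * elog z)%C.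
Proof. apply elog_eexp. Qed.

Lemma elog_gauss (a k x : R) : elog (gauss a k x) = (- a * x ^ 2, k * x).
Proof.
  unfold gauss; rewrite elog_eexp.
  unfold RtoC, Ci, Copp, Cplus, Cmult; simpl; f_equal; ring.
Qed.

(** Taking [elog] linearises the multiplicative equation into $u_t + c u_x = 0$; both existence and
    uniqueness of the exact solution use it. *)
Lemma advection_equation_log (c : R) (lx lt : C) :
  (eexp lt * eexp lx ^ RtoC c)%eC = 1%eC <-> (lt + RtoC c * lx)%C = RtoC 0.
Proof.
  split; intros h.
  - apply (f_equal elog) in h.
    now rewrite elog_mul, elog_pow, elog_one, !elog_eexp in h.
  - apply elog_inj.
    now rewrite elog_mul, elog_pow, elog_one, !elog_eexp.
Qed.

(** For a quadratic $q$, $q(y+h) - q(y-h) = 2h\,q'(y)$ without remainder. The differences with $h =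
    c\,Dt$ and $h = Dx$ are thus in the exact ratio $c\,Dt/Dx$, the negative of the exponent. *)
Lemma gauss_leapfrog (a k c Dx Dt y : R) : Dx <> 0 ->
  gauss a k (y - c * Dt) =
    (gauss a k (y + c * Dt) *
     (gauss a k (y + Dx) / gauss a k (y - Dx)) ^ RtoC (- c * Dt / Dx))%eC.
Proof.
  intros hDx; apply elog_inj.
  rewrite elog_mul, elog_pow, elog_div, !elog_gauss.
  unfold RtoC, Cminus, Cplus, Copp, Cmult; simpl; f_equal; field; exact hDx.
Qed.

Lemma scheme_gauss (a k c Dx Dt : R) (v : Z -> Z -> eC) :
  Dx <> 0 -> is_scheme c Dx Dt (gauss a k) v ->
  forall n j : Z, (0 <= n)%Z ->
    v n j = gauss a k (IZR j * Dx - c * IZR n * Dt).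
Proof.
  intros hDx [h0 [h1 hrec]].
  (* The recurrence looks back two levels, so the induction carries levels [n] and [n - 1] together,
     starting from levels 0 and -1. *)
  enough (H : forall n : Z, (0 <= n)%Z -> forall j : Z,
    v n j = gauss a k (IZR j * Dx - c * IZR n * Dt) /\
    v (n - 1)%Z j = gauss a k (IZR j * Dx - c * IZR (n - 1) * Dt)).
  { intros n j hn; apply (H n hn j). }
  apply (natlike_ind (fun n => forall j : Z,
    v n j = gauss a k (IZR j * Dx - c * IZR n * Dt) /\
    v (n - 1)%Z j = gauss a k (IZR j * Dx - c * IZR (n - 1) * Dt))).
  - intros j; split; [rewrite h0 | change (0 - 1)%Z with (-1)%Z; rewrite h1];
      f_equal; ring.
  - intros n hn IH j; unfold Z.succ.
    replace (n + 1 - 1)%Z with n by lia.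
    split; [| apply IH].
    rewrite (hrec n j hn), (proj2 (IH j)), (proj1 (IH (j + 1)%Z)),
      (proj1 (IH (j - 1)%Z)), !plus_IZR, !minus_IZR.
    (* Centre at $y = j\,Dx - c\,n\,Dt$: the new level sits at $y - c\,Dt$, the one before at $y +
       c\,Dt$, the two neighbours at $y \pm Dx$. *)
    replace (IZR j * Dx - c * (IZR n + 1) * Dt)
      with (IZR j * Dx - c * IZR n * Dt - c * Dt) by ring.
    rewrite (gauss_leapfrog a k c Dx Dt _ hDx).
    f_equal; [| f_equal; f_equal]; f_equal; ring.
Qed.

(** The coordinate projections are linear, so each component has a real derivative, which is
    unique. *)
Lemma is_derive_C_unique (f : R -> C) (x : R) (l l' : C) :
  @is_derive R_AbsRing C_R_NormedModule f x l ->
  @is_derive R_AbsRing C_R_NormedModule f x l' -> l = l'.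
Proof.
  assert (Hfst : forall m : C, @is_derive R_AbsRing C_R_NormedModule f x m ->
    is_derive (fun y => fst (f y)) x (fst m)).
  { intros m hm.
    exact (filterdiff_comp' f (fst : C -> R) x _ _ hm
      (filterdiff_linear _ (@is_linear_fst R_AbsRing R_NormedModule R_NormedModule))). }
  assert (Hsnd : forall m : C, @is_derive R_AbsRing C_R_NormedModule f x m ->
    is_derive (fun y => snd (f y)) x (snd m)).
  { intros m hm.
    exact (filterdiff_comp' f (snd : C -> R) x _ _ hm
      (filterdiff_linear _ (@is_linear_snd R_AbsRing R_NormedModule R_NormedModule))). }
  intros h h'; apply injective_projections.
  - now rewrite <- (is_derive_unique _ _ _ (Hfst l h)),
      (is_derive_unique _ _ _ (Hfst l' h')).
  - now rewrite <- (is_derive_unique _ _ _ (Hsnd l h)),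
      (is_derive_unique _ _ _ (Hsnd l' h')).
Qed.

Lemma is_derive_zero_const {V : NormedModule R_AbsRing} (f : R -> V) :
  (forall t : R, is_derive f t zero) -> forall a b : R, f a = f b.
Proof.
  intros h a b; destruct (Rtotal_order a b) as [hab | [-> | hab]].
  - now apply eq_is_derive.
  - reflexivity.
  - symmetry; now apply eq_is_derive.
Qed.

Lemma is_derive_prod {U V : NormedModule R_AbsRing} (f : R -> U) (g : R -> V)
    (x : R) (lf : U) (lg : V) :
  is_derive f x lf -> is_derive g x lg ->
  @is_derive R_AbsRing (prod_NormedModule R_AbsRing U V)
    (fun y => (f y, g y)) x (lf, lg).
Proof.
  intros hf hg.
  apply (filterdiff_comp_2 f g
    (fun u v => (u, v) : prod_NormedModule R_AbsRing U V) _ _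
    (fun u v => (u, v) : prod_NormedModule R_AbsRing U V) hf hg).
  apply filterdiff_linear, is_linear_prod;
    [apply is_linear_fst | apply is_linear_snd].
Qed.

(** Chain rule along a curve: the composite differential $y \mapsto L(y\,q)$ equals $y\,L(q)$ by
    linearity of $L$. *)
Lemma filterdiff_is_derive_comp {U V : NormedModule R_AbsRing} (F : U -> V)
    (L : U -> V) (p : R -> U) (s : R) (q : U) :
  filterdiff F (locally (p s)) L -> is_derive p s q ->
  is_derive (fun y => F (p y)) s (L q).
Proof.
  intros hF hp.
  apply (filterdiff_ext_lin _ (fun y : R => L (scal y q))).
  - exact (filterdiff_comp' p F s _ _ hp hF).
  - intros y; exact (linear_scal L (proj1 hF) y q).
Qed.

Lemma exact_solution_characteristics (c : R) (g : R -> eC) (w : R -> R -> eC) :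
  exact_solution c g w -> forall x t : R, w x t = g (x - c * t).
Proof.
  intros [hdiff [heq hinit]] x t; rewrite <- hinit; apply elog_inj.
  set (W := fun p : R * R => elog (w (fst p) (snd p))).
  (* The characteristic through $(x,t)$, parametrised by time: it is at $(x,t)$ when $s = t$ and at
     the foot $(x - ct, 0)$ when $s = 0$. *)
  set (p := fun s : R => (x - c * t + c * s, s)).
  assert (hp : forall s, @is_derive R_AbsRing
    (prod_NormedModule R_AbsRing R_NormedModule R_NormedModule) p s (c, 1)).
  { intros s; apply is_derive_prod; auto_derive; trivial; ring. }
  replace (elog (w x t)) with (W (p t))
    by (unfold W, p; simpl; do 2 f_equal; ring).
  replace (elog (w (x - c * t) 0)) with (W (p 0))
    by (unfold W, p; simpl; do 2 f_equal; ring).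
  apply (@is_derive_zero_const C_R_NormedModule (fun s => W (p s))).
  intros s.
  (* Joint differentiability provides one linear map [L] governing the oblique direction $(c,1)$ as
     well as the two axes. *)
  destruct (hdiff (fst (p s)) (snd (p s))) as [L hL].
  change (filterdiff W (locally (p s)) L) in hL.
  destruct (heq (fst (p s)) (snd (p s)))
    as (dx & dt & [lx [hx ->]] & [lt [ht ->]] & he).
  apply advection_equation_log in he.
  (* Restricting to lines parallel to the axes identifies [L] on the basis vectors with the
     logarithmic partial derivatives. *)
  assert (hLx : L (1, 0) = lx).
  { apply (is_derive_C_unique _ _ _ _
      (filterdiff_is_derive_comp W L (fun y => (y, snd (p s))) (fst (p s)) (1, 0) hL
        (is_derive_prod _ _ _ _ _ (is_derive_id _) (is_derive_const _ _))) hx). }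
  assert (hLt : L (0, 1) = lt).
  { apply (is_derive_C_unique _ _ _ _
      (filterdiff_is_derive_comp W L (fun y => (fst (p s), y)) (snd (p s)) (0, 1) hL
        (is_derive_prod _ _ _ _ _ (is_derive_const _ _) (is_derive_id _))) ht). }
  (* Since $(c,1) = (0,1) + c\,(1,0)$, this value is $u_t + c u_x$ for $u = \log w$. *)
  assert (hLc : L (c, 1) = zero).
  { transitivity (plus (L (0, 1)) (scal c (L (1, 0)))).
    - rewrite <- (linear_scal L (proj1 hL)), <- (linear_plus L (proj1 hL)).
      f_equal; unfold plus, scal; simpl; unfold prod_plus, prod_scal,
        plus, scal; simpl; unfold mult; simpl; f_equal; ring.
    - rewrite hLx, hLt.
      transitivity (lt + RtoC c * lx)%C; [| exact he].
      rewrite <- scal_R_Cmult; reflexivity. }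
  rewrite <- hLc.
  apply (filterdiff_is_derive_comp W L p s (c, 1) hL (hp s)).
Qed.

Lemma travelling_wave_exact_solution (c : R) (g : R -> eC) (g' : R -> C) :
  (forall x : R,
     @is_derive R_AbsRing C_R_NormedModule (fun y => elog (g y)) x (g' x)) ->
  exact_solution c g (fun x t => g (x - c * t)).
Proof.
  intros hg; split; [| split].
  - intros x t.
    (* The phase $x - ct$ is linear in $(x,t)$, hence its own differential; composing with [hg]
       gives joint differentiability. *)
    assert (hl : @is_linear R_AbsRing
      (prod_NormedModule R_AbsRing R_NormedModule R_NormedModule) R_NormedModule
      (fun q => fst q - c * snd q)).
    { apply (is_linear_ext (fun q : R * R => plus (fst q) (scal (- c) (snd q)))).
      { intros q; unfold plus, scal; simpl; unfold mult; simpl; ring. }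
      apply (is_linear_comp (fun q : R * R => (fst q, scal (- c) (snd q)))
        (fun q : R * R => plus (fst q) (snd q))).
      - apply is_linear_prod; [apply is_linear_fst |].
        apply (is_linear_comp (fun q : R * R => snd q) (fun y : R => scal (- c) y)).
        + apply is_linear_snd.
        + exact (@is_linear_scal_r R_AbsRing R_NormedModule (- c) Rmult_comm).
      - exact (@is_linear_plus R_AbsRing R_NormedModule). }
    eexists.
    apply (filterdiff_comp' (fun q : R * R => fst q - c * snd q)
      (fun y => elog (g y)) (x, t) _ _ (filterdiff_linear _ hl) (hg _)).
  - intros x t.
    assert (hcomp : forall (h : R -> R) (y m : R), is_derive h y m ->
      @is_derive R_AbsRing C_R_NormedModule (fun z => elog (g (h z))) y
        (RtoC m * g' (h y))%C).
    { intros h y m hh; rewrite <- scal_R_Cmult.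
      exact (@is_derive_comp R_AbsRing C_R_NormedModule
        (fun z => elog (g z)) h y _ m (hg _) hh). }
    (* The inner derivatives of $x - ct$ are $1$ in $x$ and $-c$ in $t$, so $u_t + c u_x$
       cancels. *)
    exists (eexp (RtoC 1 * g' (x - c * t))), (eexp (RtoC (- c) * g' (x - c * t))).
    split; [| split].
    + eexists; split; [| reflexivity].
      apply (hcomp (fun y => y - c * t)); auto_derive; trivial; ring.
    + eexists; split; [| reflexivity].
      apply (hcomp (fun s => x - c * s)); auto_derive; trivial; ring.
    + apply advection_equation_log.
      rewrite RtoC_opp; ring.
  - intros x; f_equal; ring.
Qed.

Lemma is_derive_elog_gauss (a k x : R) :
  @is_derive R_AbsRing C_R_NormedModule (fun y => elog (gauss a k y)) x
    (- 2 * a * x, k).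
Proof.
  apply (is_derive_ext (fun y => (- a * y ^ 2, k * y) : C_R_NormedModule)).
  { intros y; symmetry; apply elog_gauss. }
  apply (@is_derive_prod R_NormedModule R_NormedModule);
    auto_derive; trivial; ring.
Qed.

Theorem mainTheorem1 (a k c Dx Dt : R) (hDx : 0 < Dx) (hDt : 0 < Dt)
    (v : Z -> Z -> eC) (hv : is_scheme c Dx Dt (gauss a k) v) :
  (forall n j : Z, (0 <= n)%Z ->
     v n j = gauss a k (IZR j * Dx - c * IZR n * Dt)) /\
  exact_solution c (gauss a k) (fun x t => gauss a k (x - c * t)) /\
  (forall w : R -> R -> eC, exact_solution c (gauss a k) w ->
     forall x t : R, w x t = gauss a k (x - c * t)).
Proof.
  split; [| split].
  - apply scheme_gauss; [lra | exact hv].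
  - apply (travelling_wave_exact_solution c _ _ (is_derive_elog_gauss a k)).
  - apply exact_solution_characteristics.
Qed.
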